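(* Let $X$ be a finite dimensional real Banach space with $\dim X=n\geq 1$. Then for any Auerbach basis $\{(x_k,x_k^* ):1\le k\le n\}$ of $X$ there exist $n$ pairwise distinct linear combinations $z_1,\dots,z_n$ of the vectors $x_1,\dots,x_n$, all of whose coefficients belong to $\{0,1,-1\}$, such that $\|z_k\|=1$ for $1\le k\le n$ and $\|z_k+z_l\|>1$ for $1\le k<l\le n$.
   Context: An Auerbach basis of an $n$-dimensional Banach space $X$ is a family of pairs $\{(x_k,x_k^* ):1\le k\le n\}\subseteq X\times X^*$ such that $x_i^*(x_j)=\delta_{ij}$ for all $i,j$ and $\|x_k\|=\|x_k^*\|=1$ for all $k$. *)

(* Defs.v *)
From HB Require Import structures.
From mathcomp Require Import all_boot all_order all_algebra.
From mathcomp Require Import boolp classical_sets reals topology normedtype.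

Set Implicit Arguments.
Unset Strict Implicit.
Unset Printing Implicit Defensive.

Import Order.TTheory GRing.Theory Num.Theory.
Import numFieldNormedType.Exports.

Local Open Scope classical_set_scope.
Local Open Scope ring_scope.

(* The vectType component only provides the (finite) dimension \dim {:X};
   the norm is arbitrary. *)
#[short(type="finDimBanachType")]
HB.structure Definition FinDimBanach (K : numFieldType) :=
  {X of CompleteNormedModule K X & Vector K X}.

Definition dual_norm (R : realType) (X : normedModType R)
    (f : {linear X -> R^o}) : R :=
  sup [set (`|f x| : R) | x in [set x : X | `|x| <= 1]].

(* X^* is the space of continuous linear functionals, hence the continuity
   clause.  The number of pairs is tied to the dimension here. *)
Definition auerbach_basis (R : realType) (X : finDimBanachType R) (n : nat)
    (x : 'I_n -> X) (xs : 'I_n -> {linear X -> R^o}) : Prop :=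
  [/\ \dim {:X} = n,
      forall i, continuous (xs i),
      forall i j, xs i (x j) = (i == j)%:R,
      forall k, `|x k| = 1
    & forall k, dual_norm (xs k) = 1].

Definition sign_combination (R : realType) (X : lmodType R) (n : nat)
    (x : 'I_n -> X) (z : X) : Prop :=
  exists2 c : 'I_n -> R,
    forall j, c j \in [:: 0; 1; -1] & z = \sum_(j < n) c j *: x j.

(* Main.v *)
(** Order the coefficient vectors in {0,1,-1}^n by the functional
    [c |-> \sum_j 2^j c_j].  Let [z_k] be the combination with leading term [x_k]
    (coefficient [1] at [k], [0] above [k]) that has norm one and the largest
    such value; this value is positive.  Since coordinates are bounded by the
    norm, for [k < l] the inequality [|z_k + z_l| <= 1] would make [z_k + z_l]
    a unit {0,1,-1}-combination with leading term [x_l] and a larger value than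
    [z_l], contradicting the choice of [z_l]. *)

Require Import Defs.
From HB Require Import structures.
From mathcomp Require Import all_boot all_order all_algebra.
From mathcomp Require Import boolp classical_sets reals topology normedtype.

Set Implicit Arguments.
Unset Strict Implicit.
Unset Printing Implicit Defensive.

Import Order.TTheory GRing.Theory Num.Theory.
Import numFieldNormedType.Exports.

Local Open Scope classical_set_scope.
Local Open Scope ring_scope.

(** For nonzero [v], normalising [v] gives a point of the unit ball. The hypothesis on [dual_norm f]
    guarantees that the supremum is a genuine one. *)
Lemma le_dual_norm (R : realType) (X : normedModType R)
    (f : {linear X -> R^o}) (v : X) :
  dual_norm f != 0 -> `|f v| <= dual_norm f * `|v|.
Proof.
(* [sup] is [0] on sets without a supremum. *)
move=> f_neq0; rewrite /dual_norm; set A := (X in sup X).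
have supA : has_sup A.
  by apply: contrapT => /sup_out A0; move: f_neq0; rewrite /dual_norm A0 eqxx.
have [->|v0] := eqVneq v 0; first by rewrite linear0 !normr0 mulr0.
have nv : 0 < `|v| by rewrite normr_gt0.
rewrite -ler_pdivrMr //; apply: (ub_le_sup (proj2 supA)).
exists (`|v|^-1 *: v) => /=; first by rewrite normrZ normfV normr_id mulVf ?gt_eqF.
by rewrite linearZ /= normrM normfV normr_id mulrC.
Qed.

(** Functions with values in [s] are decoded from the finite type [{ffun I -> seq_sub s}], where a
    maximum exists. *)
Lemma exists_max_finite_range (R : realDomainType) (I : finType) (T : choiceType)
    (s : seq T) (P : (I -> T) -> Prop) (F : (I -> T) -> R) (c0 : I -> T) :
  (forall c, P c -> forall i, c i \in s) -> P c0 ->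
  exists2 c, P c & forall d, P d -> F d <= F c.
Proof.
move=> Ps Pc0.
pose dec (e : {ffun I -> seq_sub s}) : I -> T := fun i => val (e i).
have enc c : P c -> exists e, dec e = c.
  move=> Pc; exists [ffun i => SeqSub (Ps _ Pc i)].
  by apply/funext => i; rewrite /dec ffunE.
have [e0 e0E] := enc _ Pc0.
have Pe0 : `[< P (dec e0) >] by rewrite e0E; apply/asboolP.
case: (@arg_maxP _ _ _ e0 (fun e => `[< P (dec e) >]) (F \o dec) Pe0).
move=> e /asboolP Pe emax; exists (dec e) => // d Pd.
have [e' e'E] := enc _ Pd; rewrite -e'E.
by apply: emax; rewrite e'E; apply/asboolP.
Qed.

(** Only [1 + 1] and [-1 - 1] leave the set, and both violate the bound. *)
Lemma sign_add_closed (R : realDomainType) (a b : R) :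
  a \in [:: 0; 1; -1] -> b \in [:: 0; 1; -1] -> `|a + b| <= 1 ->
  a + b \in [:: 0; 1; -1].
Proof.
rewrite !inE => /or3P[] /eqP-> /or3P[] /eqP->;
  rewrite ?add0r ?addr0 ?subrr ?addNr ?eqxx ?orbT //.
  by rewrite ger0_norm ?addr_ge0 // gerDl ler10.
by rewrite -opprD normrN ger0_norm ?addr_ge0 // gerDl ler10.
Qed.

Definition leading_one (R : pzRingType) (n : nat) (k : 'I_n) (c : 'I_n -> R) :=
  c k = 1 /\ forall j : 'I_n, (k < j)%N -> c j = 0.

(** The leading [2 ^+ k] exceeds the sum of all lower powers of two, so the lower terms cannot
    cancel it. *)
Lemma binary_weight_gt0 (R : realDomainType) (n : nat) (k : 'I_n) (c : 'I_n -> R) :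
  (forall j, c j \in [:: 0; 1; -1]) -> leading_one k c ->
  0 < \sum_(j < n) c j * 2 ^+ j.
Proof.
move=> cs [ck c0].
have low : \sum_(j < n | (j < k)%N) (2 ^+ j : R) < 2 ^+ k.
  rewrite -(big_ord_widen n (fun j => 2 ^+ j : R)) 1?ltnW //.
  elim: (nat_of_ord k) => [|m IH]; first by rewrite big_ord0 expr0.
  by rewrite big_ord_recr exprS mulr_natl mulr2n ltrD2r.
rewrite (bigD1 k) //= ck mul1r -ltrBlDl sub0r.
apply: lt_le_trans (_ : - \sum_(j < n | (j < k)%N) (2 ^+ j : R) <= _).
  by rewrite ltrN2.
(* Termwise comparison over all indices: below [k] the coefficient is at least [-1], above [k] it
   vanishes. *)
rewrite -sumrN big_mkcond [leRHS]big_mkcond ler_sum //= => j _.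
case: (ltngtP j k) => [jk|kj|/val_inj->]; last by rewrite eqxx.
- rewrite neq_ltn jk /= -mulN1r ler_pM2r ?exprn_gt0 //.
  by have := cs j; rewrite !inE => /or3P[] /eqP->; rewrite ?lerN10 ?ge0_cp ?ler01.
- by rewrite c0 // mul0r if_same.
Qed.

Theorem theorem2p3 (R : realType) (X : finDimBanachType R) (n : nat)
    (n_ge1 : (1 <= n)%N) (dimX : \dim {:X} = n)
    (x : 'I_n -> X) (xs : 'I_n -> {linear X -> R^o})
    (x_xs : auerbach_basis x xs) :
  exists z : 'I_n -> X,
    [/\ injective z,
        forall k, sign_combination x (z k),
        forall k, `|z k| = 1
      & forall k l : 'I_n, (k < l)%N -> 1 < `|z k + z l|].
Proof.
case: x_xs => _ _ xsx x1 xs1.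
pose comb (c : 'I_n -> R) : X := \sum_(j < n) c j *: x j.
pose w (c : 'I_n -> R) : R := \sum_(j < n) c j * 2 ^+ j.
have coordE c i : xs i (comb c) = c i.
  rewrite /comb linear_sum (bigD1 i) //= big1 => [|j ji].
    by rewrite addr0 linearZ /= xsx eqxx; exact: mulr1.
  by rewrite linearZ /= xsx eq_sym (negbTE ji); exact: mulr0.
have coord_le c i : `|c i| <= `|comb c|.
  rewrite -{1}(coordE c i) -[leRHS]mul1r -(xs1 i).
  by apply: le_dual_norm; rewrite xs1 oner_neq0.
pose P k (c : 'I_n -> R) :=
  [/\ forall j, c j \in [:: 0; 1; -1], leading_one k c & `|comb c| = 1].
have exmax k : exists c, P k c /\ forall d, P k d -> w d <= w c.
  (* The indicator of [k], whose combination is [x k], shows that [P k] is inhabited. *)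
  have [] := @exists_max_finite_range R _ _ [:: 0; 1; -1] (P k) w
    (fun j => (j == k)%:R).
  - by move=> c [].
  - split.
    + by move=> j; case: eqP => _; rewrite !inE eqxx ?orbT.
    + by split=> [|j kj]; rewrite ?eqxx // -val_eqE gtn_eqF.
    + rewrite /comb (bigD1 k) //= big1 => [|j /negbTE->]; last by rewrite scale0r.
      by rewrite eqxx scale1r addr0 x1.
  - by move=> c Pc cmax; exists c.
have [c cP] := choice exmax.
have sepc (k l : 'I_n) : (k < l)%N -> 1 < `|comb (c k) + comb (c l)|.
  move=> kl; have [[sk lk nk] _] := cP k; have [[sl ll nl] maxl] := cP l.
  rewrite ltNge; apply/negP => le1.
  pose d j := c k j + c l j.
  have combd : comb d = comb (c k) + comb (c l).
    by rewrite /comb -big_split; apply: eq_bigr => j _; rewrite scalerDl.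
  have dl : d l = 1 by rewrite /d lk.2 // ll.1 add0r.
  have Pd : P l d.
    split.
    - move=> j; apply: sign_add_closed => //.
      by apply: le_trans le1; rewrite -combd; exact: coord_le.
    - by split=> // j lj; rewrite /d lk.2 ?(ltn_trans kl) // ll.2 // addr0.
    (* The norm is at least one because the coordinate at [l] is [1]. *)
    - apply/eqP; rewrite eq_le combd le1 -combd /=.
      by rewrite -[leLHS]normr1 -dl coord_le.
  have := maxl _ Pd; rewrite leNgt => /negP; apply.
  have -> : w d = w (c k) + w (c l).
    by rewrite /w -big_split; apply: eq_bigr => j _; rewrite mulrDl.
  by rewrite ltrDr; apply: binary_weight_gt0 sk lk.
(* The coordinate at [l] separates the two: it is [0] for [c k] and [1] for [c l]. *)
have comb_neq (k l : 'I_n) : (k < l)%N -> comb (c k) <> comb (c l).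
  move=> kl /(congr1 (xs l)); rewrite !coordE.
  have [[_ lk _] _] := cP k; have [[_ ll _] _] := cP l.
  by rewrite lk.2 // ll.1 => /esym/eqP; rewrite oner_eq0.
exists (fun k => comb (c k)); split=> //.
- move=> k l ckl; apply/val_inj; case: (ltngtP k l) => // [/comb_neq//|/comb_neq].
  by rewrite ckl.
- by move=> k; exists (c k) => //; have [[]] := cP k.
- by move=> k; have [[]] := cP k.
Qed.
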